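(* Let $f_1,\dots,f_n:\mathbb{R}^d\to\mathbb{R}$ be convex and $L$-smooth, let $\sigma>0$, $\kappa=1+L/\sigma$, and let $\theta_\star$ be the minimizer of $\theta\mapsto\sum_{i=1}^n\left[f_i(\theta)+\frac{\sigma}{2}\|\theta\|^2\right]$. For $\varepsilon>0$, the number of steps required by the Token Gradient Descent algorithm (defined in the context) with a single token ($K=1$) and $p_{\rm comp}=p_{\rm comm}=\frac12$ to reach error $\|\theta_t-\theta_\star\|^2\le\varepsilon$ is of order $$T_{\rm comp}=O\left(\kappa\log\varepsilon^{-1}\right)\quad\text{and}\quad T_{\rm comm}=O\left(n\kappa\log\varepsilon^{-1}\right),$$ where $T_{\rm comp}$ is the expected number of gradient steps performed by each node, and $T_{\rm comm}$ is the expected number of communication updates (jumps) performed by the token.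
   Context: Each $f_i$ is the local function of node $i$; it is twice continuously differentiable and strictly convex, with $0\preccurlyeq\nabla^2 f_i(x)\preccurlyeq L I_d$ for all $x$. The $n$ nodes are connected by a complete communication graph, so a token may jump from any node to any other. The $O(\cdot)$ ignores the logarithmic dependence on a constant determined by the initialization. Here $\theta_t$ collects the parameters $\theta_t^{(i)}$ of all nodes and the parameters $\theta_t^{{\rm token},k}$ of all tokens, and is compared with $\theta_\star$ block by block. Token Gradient Descent with $K\ge1$ tokens, with probabilities $p_{\rm comm}+p_{\rm comp}=1$. Parameters: $$\tilde\sigma=\frac{n}{n+K}\sigma,\quad \alpha=\frac{2K}{L},\quad \eta=\min\left(\frac{\tilde\sigma p_{\rm comm}}{2nK},\frac{p_{\rm comp}}{n\alpha(1+L/\tilde\sigma)}\right),\quad \rho_{\rm comm}=\frac{nK\eta}{p_{\rm comm}\tilde\sigma},\quad \rho_{\rm comp}=\frac{n\alpha\eta}{p_{\rm comp}}.$$ Initialization: $z_0^{(i)}\in\mathbb{R}^d$ arbitrary and $\theta_0^{(i)}=-\nabla f_i(z_0^{(i)})/\tilde\sigma$ for $i\in\{1,\dots,n\}$; $\theta_0^{{\rm token},k}=0$ for $k\in\{1,\dots,K\}$. At each iteration $t=0,1,2,\dots$ (variables not mentioned are unchanged): - With probability $p_{\rm comm}$ (communication step): pick $i$ uniformly in $\{1,\dots,n\}$ and $k$ uniformly in $\{1,\dots,K\}$ (token $k$ jumps to node $i$), and set $\theta_{t+1}^{{\rm token},k}=\theta_t^{{\rm token},k}-\rho_{\rm comm}(\theta_t^{{\rm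 token},k}-\theta_t^{(i)})$ and $\theta_{t+1}^{(i)}=\theta_t^{(i)}+\rho_{\rm comm}(\theta_t^{{\rm token},k}-\theta_t^{(i)})$. - Otherwise (computation step): pick $i$ uniformly in $\{1,\dots,n\}$ and set $z_{t+1}^{(i)}=(1-\rho_{\rm comp})z_t^{(i)}+\rho_{\rm comp}\theta_t^{(i)}$ and $\theta_{t+1}^{(i)}=\theta_t^{(i)}-\frac{1}{\tilde\sigma}\left(\nabla f_i(z_{t+1}^{(i)})-\nabla f_i(z_t^{(i)})\right)$.
   Formalization: The constant in O(·) is uniform over κ ≥ κ₀ for each fixed κ₀ > 1 and may depend on κ₀; with the stated step sizes no absolute constant works as κ → 1 (already n = 1, quadratic f needs about (σ/L) log(1/ε) steps). The error is read in expectation. *)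

(* Defs.v *)
From HB Require Import structures.
From mathcomp Require Import all_boot all_order all_algebra.
From mathcomp Require Import all_classical all_reals all_analysis.

Set Implicit Arguments.
Unset Strict Implicit.
Unset Printing Implicit Defensive.

Import Order.TTheory GRing.Theory Num.Theory.
Import numFieldNormedType.Exports.

Local Open Scope classical_set_scope.
Local Open Scope ring_scope.

(* The squared Euclidean norm; the library norm `|v| on 'rV[R]_d is the sup
   norm (it is only used below through the topology). *)
Definition sqnorm (R : realType) (d : nat) (v : 'rV[R]_d) : R :=
  \sum_(j < d) v ord0 j ^+ 2.

Definition grad (R : realType) (d : nat) (f : 'rV[R]_d -> R) (x : 'rV[R]_d) :
    'rV[R]_d :=
  \row_(j < d) 'D_(delta_mx ord0 j) f x.

Definition hess (R : realType) (d : nat) (f : 'rV[R]_d -> R) (x : 'rV[R]_d) :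
    'M[R]_d :=
  'J (grad f) x.

Definition twice_cont_diff (R : realType) (d : nat) (f : 'rV[R]_d -> R) : Prop :=
  [/\ forall x, differentiable f x,
      forall x, differentiable (grad f) x
    & continuous (hess f)].

Definition loewner_le (R : realType) (d : nat) (A B : 'M[R]_d) : Prop :=
  forall v : 'rV[R]_d, 0 <= (v *m (B - A) *m v^T) ord0 ord0.

Definition strictly_convex (R : realType) (d : nat) (f : 'rV[R]_d -> R) : Prop :=
  forall (x y : 'rV[R]_d) (s : R), x != y -> 0 < s -> s < 1 ->
    f ((1 - s) *: x + s *: y) < (1 - s) * f x + s * f y.

Definition local_function (R : realType) (d : nat) (L : R)
    (f : 'rV[R]_d -> R) : Prop :=
  [/\ twice_cont_diff f, strictly_convex f
    & forall x, loewner_le 0 (hess f x) /\ loewner_le (hess f x) L%:M].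

Definition objective (R : realType) (n d : nat) (sigma : R)
    (f : 'I_n -> 'rV[R]_d -> R) (theta : 'rV[R]_d) : R :=
  \sum_(i < n) (f i theta + sigma / 2 * sqnorm theta).

Definition is_minimizer (R : realType) (d : nat) (F : 'rV[R]_d -> R)
    (x : 'rV[R]_d) : Prop :=
  forall y, F x <= F y.

Definition sigma_tilde (R : realType) (n K : nat) (sigma : R) : R :=
  n%:R / (n + K)%:R * sigma.

Definition alpha (R : realType) (K : nat) (L : R) : R := 2 * K%:R / L.

Definition eta (R : realType) (n K : nat) (L sigma p_comm p_comp : R) : R :=
  let st := sigma_tilde n K sigma in
  Num.min (st * p_comm / (2 * n%:R * K%:R))
          (p_comp / (n%:R * alpha K L * (1 + L / st))).

Definition rho_comm (R : realType) (n K : nat) (L sigma p_comm p_comp : R) : R :=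
  n%:R * K%:R * eta n K L sigma p_comm p_comp
    / (p_comm * sigma_tilde n K sigma).

Definition rho_comp (R : realType) (n K : nat) (L sigma p_comm p_comp : R) : R :=
  n%:R * alpha K L * eta n K L sigma p_comm p_comp / p_comp.

(* The random choice made at one iteration: [Comm i k] when token k jumps to
   node i, [Comp i] when node i performs a gradient step. *)
Inductive action (n K : nat) : Type :=
  | Comm of 'I_n & 'I_K
  | Comp of 'I_n.

Arguments Comm {n K} i k.
Arguments Comp {n K} i.

Definition is_comp (n K : nat) (i : 'I_n) (a : action n K) : bool :=
  if a is Comp j then j == i else false.

Definition is_comm (n K : nat) (k : 'I_K) (a : action n K) : bool :=
  if a is Comm _ l then l == k else false.

Definition action_prob (R : realType) (n K : nat) (p_comm p_comp : R)
    (a : action n K) : R :=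
  match a with
  | Comm _ _ => p_comm / (n%:R * K%:R)
  | Comp _ => p_comp / n%:R
  end.

Record state (R : realType) (n K d : nat) : Type := State {
  node_z : 'I_n -> 'rV[R]_d;
  node_theta : 'I_n -> 'rV[R]_d;
  token_theta : 'I_K -> 'rV[R]_d
}.

Definition update (T : eqType) (V : Type) (g : T -> V) (i : T) (v : V) : T -> V :=
  fun j => if j == i then v else g j.

Definition tgd_init (R : realType) (n K d : nat) (sigma : R)
    (f : 'I_n -> 'rV[R]_d -> R) (z0 : 'I_n -> 'rV[R]_d) : state R n K d :=
  State z0
    (fun i => - ((sigma_tilde n K sigma)^-1 *: grad (f i) (z0 i)))
    (fun=> 0).

Definition tgd_step (R : realType) (n K d : nat) (L sigma p_comm p_comp : R)
    (f : 'I_n -> 'rV[R]_d -> R) (s : state R n K d) (a : action n K) :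
    state R n K d :=
  match a with
  | Comm i k =>
      let r := rho_comm n K L sigma p_comm p_comp in
      let diff := token_theta s k - node_theta s i in
      State (node_z s)
        (update (node_theta s) i (node_theta s i + r *: diff))
        (update (token_theta s) k (token_theta s k - r *: diff))
  | Comp i =>
      let r := rho_comp n K L sigma p_comm p_comp in
      let z' := (1 - r) *: node_z s i + r *: node_theta s i in
      State (update (node_z s) i z')
        (update (node_theta s) i
           (node_theta s i - (sigma_tilde n K sigma)^-1 *:
              (grad (f i) z' - grad (f i) (node_z s i))))
        (token_theta s)
  end.

Fixpoint tgd (R : realType) (n K d : nat) (L sigma p_comm p_comp : R)
    (f : 'I_n -> 'rV[R]_d -> R) (z0 : 'I_n -> 'rV[R]_d)
    (a : nat -> action n K) (t : nat) : state R n K d :=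
  if t is t'.+1
  then tgd_step L sigma p_comm p_comp f
         (tgd L sigma p_comm p_comp f z0 a t') (a t')
  else tgd_init K sigma f z0.

Definition sqerror (R : realType) (n K d : nat) (s : state R n K d)
    (theta_star : 'rV[R]_d) : R :=
  \sum_(i < n) sqnorm (node_theta s i - theta_star)
  + \sum_(k < K) sqnorm (token_theta s k - theta_star).

(* The variables X 0, X 1, ... are independent and all have law [action_prob]:
   since actions range over a finite set, this says that the joint law of every
   initial segment X 0, ..., X (t - 1) is the product law. *)
Definition iid_actions (R : realType) (n K : nat) (p_comm p_comp : R)
    (disp : measure_display) (Omega : measurableType disp)
    (P : probability Omega R) (X : nat -> Omega -> action n K) : Prop :=
  (forall t a, measurable (X t @^-1` [set a])) /\
  (forall (t : nat) (a : nat -> action n K),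
     P (\bigcap_(s < t) (X s @^-1` [set a s])) =
     (\prod_(s < t) action_prob p_comm p_comp (a s))%:E).

Definition expected_comp (R : realType) (n K : nat)
    (disp : measure_display) (Omega : measurableType disp)
    (P : probability Omega R) (X : nat -> Omega -> action n K)
    (T : nat) (i : 'I_n) : \bar R :=
  'E_P[fun omega => (\sum_(t < T) is_comp i (X t omega))%:R]%E.

Definition expected_comm (R : realType) (n K : nat)
    (disp : measure_display) (Omega : measurableType disp)
    (P : probability Omega R) (X : nat -> Omega -> action n K)
    (T : nat) (k : 'I_K) : \bar R :=
  'E_P[fun omega => (\sum_(t < T) is_comm k (X t omega))%:R]%E.

Definition expected_sqerror (R : realType) (n K d : nat)
    (L sigma p_comm p_comp : R)
    (f : 'I_n -> 'rV[R]_d -> R) (z0 : 'I_n -> 'rV[R]_d)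
    (theta_star : 'rV[R]_d)
    (disp : measure_display) (Omega : measurableType disp)
    (P : probability Omega R) (X : nat -> Omega -> action n K)
    (t : nat) : \bar R :=
  'E_P[fun omega =>
         sqerror (tgd L sigma p_comm p_comp f z0 (X ^~ omega) t) theta_star]%E.

(* log (C0 / eps), truncated at 0 because it bounds numbers of steps for every
   eps > 0, including those at or above the initialization constant C0. *)
Definition log_ratio (R : realType) (C0 eps : R) : R :=
  Num.max 0 (ln (C0 / eps)).

(* Main.v *)
Require Import Defs.
From HB Require Import structures.
From mathcomp Require Import all_boot all_order all_algebra.
From mathcomp Require Import all_classical all_reals all_analysis.
From mathcomp Require Import measurable_realfun.
From mathcomp Require Import ring lra.
Import Order.TTheory GRing.Theory Num.Theory.
Import numFieldNormedType.Exports.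
Set Implicit Arguments.
Unset Strict Implicit.
Local Open Scope classical_set_scope.
Local Open Scope ring_scope.

(** The algorithm is a randomised Bregman coordinate descent on a dual problem,
    and the rate comes from a potential function V of the state.

    Write c for sigma_tilde, xs for the minimizer, and put
      e_i = theta_i - xs,    e_tok = theta_tok - xs,
      u_i = e_i + (grad f_i (z_i) - grad f_i (xs)) / c.
    As n sigma = (n + 1) c, the point where all z_i, theta_i and theta_tok equal
    xs is the rest point.  A jump changes u_i and leaves z_i alone, while a
    computation step changes z_i and leaves u_i alone; the dual coordinates are
    the u_i and the grad f_i (z_i).  Indeed
    theta_i + grad f_i (z_i) / c is what node i has received from the token so
    far.  Whatever the nodes receive the token loses, hence sum_i u_i = - e_tok
    along every run ([mass_balanced], [sum_flow_gap]).  With D_f the Bregman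
    divergence of f, the dual objective exceeds its optimal value by
      F = c/2 (sum_i |e_i|^2 + |e_tok|^2) + sum_i D_{f_i}(xs, z_i).
    A jump is a gradient step on F in the coordinate u_i; a computation step is
    a mirror step in the coordinate grad f_i (z_i), with the convex conjugate of
    f_i as mirror map.  The potential
      V = F + c (c + L) / L sum_i |u_i|^2 + (c + L) / c sum_i D_{f_i}(z_i, xs)
    adds to F the squared distances to the optimum in the geometries of these
    two steps, each divided by its step size.  The step sizes are just small
    enough for F to absorb the second-order terms, so that a step in one
    coordinate lowers V by at least (partial gradient of F) . (distance to the
    optimum) in that coordinate ([lyapunov_comm], [lyapunov_comp]).  Each of the
    2 n possible steps has probability 1 / (2 n), so the mean drop of V is
    1 / (2 n) times the full inner product, which equals
      G = c (sum_i |e_i|^2 + |e_tok|^2)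
          + sum_i <grad f_i (z_i) - grad f_i (xs), z_i - xs>
    by the balance of masses ([avg_lyapunov]).  Cocoercivity of the gradients
    gives V <= (c + L) / c (3 + c / L) G ([lyapunov_le_decrease]), and that
    factor is at most C kappa.  So V contracts in mean by 1 - 1 / (2 n C kappa)
    per step, and it dominates the squared error.

    The process up to time t takes finitely many values, so expectations are
    computed without kernels: splitting the sample space by the actions drawn so
    far shows that the expectation of a function of the state is obtained by
    iterating the one-step average ([expectation_run]).  The numbers of gradient
    steps and of jumps are counters to which the same lemma applies; in T steps
    their means are T / (2 n) and T / 2. *)

(** * The Euclidean inner product *)

Definition dot (R : realType) (d : nat) (u v : 'rV[R]_d) : R :=
  \sum_(j < d) u ord0 j * v ord0 j.

Lemma sqnormE (R : realType) (d : nat) (u : 'rV[R]_d) : sqnorm u = dot u u.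
Proof. by apply: eq_bigr => j _; rewrite expr2. Qed.

Lemma dotC (R : realType) (d : nat) (u v : 'rV[R]_d) : dot u v = dot v u.
Proof. by apply: eq_bigr => j _; rewrite mulrC. Qed.

Lemma dotDl (R : realType) (d : nat) (u v w : 'rV[R]_d) :
  dot (u + v) w = dot u w + dot v w.
Proof. by rewrite -big_split; apply: eq_bigr => j _; rewrite mxE mulrDl. Qed.

Lemma dotZl (R : realType) (d : nat) (a : R) (u v : 'rV[R]_d) :
  dot (a *: u) v = a * dot u v.
Proof. by rewrite mulr_sumr; apply: eq_bigr => j _; rewrite mxE mulrA. Qed.

Lemma dotNl (R : realType) (d : nat) (u v : 'rV[R]_d) :
  dot (- u) v = - dot u v.
Proof. by rewrite -scaleN1r dotZl mulN1r. Qed.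

Lemma dot0l (R : realType) (d : nat) (v : 'rV[R]_d) : dot 0 v = 0.
Proof. by rewrite -(scale0r 0) dotZl mul0r. Qed.

Lemma dotDr (R : realType) (d : nat) (u v w : 'rV[R]_d) :
  dot w (u + v) = dot w u + dot w v.
Proof. by rewrite dotC dotDl !(dotC w). Qed.

Lemma dotZr (R : realType) (d : nat) (a : R) (u v : 'rV[R]_d) :
  dot u (a *: v) = a * dot u v.
Proof. by rewrite dotC dotZl (dotC u). Qed.

Lemma dotNr (R : realType) (d : nat) (u v : 'rV[R]_d) :
  dot u (- v) = - dot u v.
Proof. by rewrite dotC dotNl (dotC u). Qed.

Definition dotE := (dotDl, dotDr, dotNl, dotNr, dotZl, dotZr).

Lemma dot_suml (R : realType) (d : nat) (I : finType) (F : I -> 'rV[R]_d) v :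
  dot (\sum_i F i) v = \sum_i dot (F i) v.
Proof.
by apply: (big_morph (fun u => dot u v)) => [x y|]; rewrite ?dotDl ?dot0l.
Qed.

Lemma dot_ge0 (R : realType) (d : nat) (u : 'rV[R]_d) : 0 <= dot u u.
Proof. by apply: sumr_ge0 => j _; rewrite -expr2 sqr_ge0. Qed.

Lemma dot_eq0 (R : realType) (d : nat) (u : 'rV[R]_d) : dot u u <= 0 -> u = 0.
Proof.
move=> u0; apply/rowP => j; rewrite mxE; apply/eqP; rewrite -sqrf_eq0 expr2.
have /psumr_eq0P/(_ j)-> // : \sum_(j < d) u ord0 j * u ord0 j = 0.
  by apply/eqP; rewrite eq_le u0 dot_ge0.
by move=> i _; rewrite -expr2 sqr_ge0.
Qed.

(** * Smooth convex functions *)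

Lemma taylor2_le (R : realType) (phi dphi ddphi : R -> R) (M : R) :
  (forall t : R, is_derive t 1 phi (dphi t)) ->
  (forall t : R, is_derive t 1 dphi (ddphi t)) ->
  (forall t, ddphi t <= M) ->
  phi 1 - phi 0 - dphi 0 <= M / 2.
Proof.
move=> d1 d2 ddM.
have cont (g dg : R -> R) (a b : R) : (forall t : R, is_derive t 1 g (dg t)) ->
    {within `[a, b], continuous g}.
  by move=> dg'; apply: derivable_within_continuous => x _; case: (dg' x).
have dphi_le t : 0 < t -> dphi t - dphi 0 <= M * t.
  move=> t0; have [c _ ->] := MVT t0 (fun x _ => d2 x) (cont _ _ _ _ d2).
  by rewrite subr0 ler_wpM2r// ltW.
pose psi (t : R) := phi t - t * dphi 0 - M / 2 * t ^+ 2.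
pose dpsi (t : R) := dphi t - dphi 0 - M * t.
have dpsiP (t : R) : is_derive t 1 psi (dpsi t).
  have e1 := d1 t.
  rewrite /psi; apply: is_derive_eq.
  by rewrite /dpsi /GRing.scale /=; field.
have [c /itvP cab] := MVT ltr01 (fun x _ => dpsiP x) (cont _ _ _ _ dpsiP).
have := dphi_le c; rewrite cab => /(_ isT).
by rewrite /psi /dpsi; lra.
Qed.

Section SmoothConvex.
Context (R : realType) (d : nat).
Implicit Types (f : 'rV[R]_d -> R) (x y z v : 'rV[R]_d).

Lemma derive_dot_grad f x v : differentiable f x ->
  'D_v f x = dot (grad f x) v.
Proof.
move=> df; rewrite deriveE// {1}(row_sum_delta v) linear_sum/=.
by apply: eq_bigr => j _; rewrite linearZ/= mxE deriveE// mulrC.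
Qed.

Lemma derive_grad_dot f x v w : differentiable (grad f) x ->
  is_derive x v (fun y => dot (grad f y) w) ((v *m hess f x *m w^T) ord0 ord0).
Proof.
move=> df; rewrite -deriveEjacobian// mxE.
have /derivable_mxP dg : derivable (grad f) x v by exact: diff_derivable.
have -> : (fun y => dot (grad f y) w) =
  \sum_(j < d) (w ord0 j *: (fun y => grad f y ord0 j)).
  apply/funext => y; rewrite fct_sumE.
  by apply: eq_bigr => j _; rewrite mulrC.
have H j : is_derive x v (fun y => grad f y ord0 j) ('D_v (grad f) x ord0 j).
  by apply: DeriveDef => //; rewrite derive_mx ?mxE//; exact: diff_derivable.
apply: is_derive_eq; apply: eq_bigr => j _.
by rewrite mxE mulrC.
Qed.

Lemma is_derive_line f (df : R -> R) x v :
  (forall t, is_derive (x + t *: v) v f (df t)) ->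
  forall t : R, is_derive t 1 (fun t => f (x + t *: v)) (df t).
Proof.
move=> H t; have [+ +] := H t; rewrite /derivable /derive.
set F := fun h => _; set F' := fun h : R => _.
have -> : F = fun h : R =>
    h^-1 *: (f (x + (h *: (1 : R) + t) *: v) - f (x + t *: v)).
  apply/funext => h; rewrite /F /=; congr (_ *: (f _ - _)).
  by rewrite scalerDl [_ *: 1]mulr1 addrCA.
by move=> ? ?; apply: DeriveDef.
Qed.

Definition bregman f x y : R := f x - f y - dot (grad f y) (x - y).

(** Second-order Taylor bounds along the segment from y to x, where the second
    derivative is a value of the Hessian form. *)
Lemma bregman_bounds (L : R) f x y : local_function L f ->
  0 <= bregman f x y <= L / 2 * dot (x - y) (x - y).
Proof.
case=> -[df dg _] _ hf; set v := x - y.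
pose phi t := f (y + t *: v); pose dphi t := dot (grad f (y + t *: v)) v.
pose ddphi t := (v *m hess f (y + t *: v) *m v^T) ord0 ord0.
have d1 (t : R) : is_derive t 1 phi (dphi t).
  apply: is_derive_line => s; rewrite /dphi -derive_dot_grad//.
  by apply/derivableP/diff_derivable.
have d2 (t : R) : is_derive t 1 dphi (ddphi t).
  apply: (is_derive_line (f := fun z => dot (grad f z) v)) => s.
  exact: derive_grad_dot.
have qge t : 0 <= ddphi t.
  by have [/(_ v)] := hf (y + t *: v); rewrite subr0.
have qle t : ddphi t <= L * dot v v.
  have [_ /(_ v)] := hf (y + t *: v).
  have -> : dot v v = (v *m v^T) ord0 ord0.
    by rewrite mxE; apply: eq_bigr => j _; rewrite !mxE.
  rewrite mulmxBr mulmxBl mul_mx_scalar -scalemxAl.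
  have entry (A B : 'M[R]_1) : (L *: A - B) ord0 ord0 =
    L * A ord0 ord0 - B ord0 ord0 by rewrite !mxE.
  by rewrite entry subr_ge0.
have E : bregman f x y = phi 1 - phi 0 - dphi 0.
  by rewrite /bregman /phi /dphi scale1r scale0r addr0 [y + v]addrC subrK.
apply/andP; split; last by rewrite E mulrAC; exact: taylor2_le d1 d2 qle.
have := @taylor2_le _ (\- phi) (\- dphi) (\- ddphi) 0
  (fun t => is_deriveN (d1 t)) (fun t => is_deriveN (d2 t)).
have nge t : (\- ddphi) t <= 0 by rewrite oppr_le0.
by move=> /(_ nge) /=; rewrite E; lra.
Qed.

Lemma bregman_ge0 (L : R) f x y : local_function L f -> 0 <= bregman f x y.
Proof. by move=> /(bregman_bounds x y)/andP[]. Qed.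

Lemma bregman_le (L : R) f x y : local_function L f ->
  bregman f x y <= L / 2 * dot (x - y) (x - y).
Proof. by move=> /(bregman_bounds x y)/andP[]. Qed.

(** The function bregman f _ y is nonnegative and L-smooth, with gradient
    g = grad f x - grad f y at x.  The gradient step x - g / L lowers it by at
    least |g|^2 / (2 L) and leaves it nonnegative. *)
Lemma bregman_cocoercive (L : R) f x y : 0 < L -> local_function L f ->
  dot (grad f x - grad f y) (grad f x - grad f y) <= 2 * L * bregman f x y.
Proof.
move=> L0 hf; set g := grad f x - grad f y.
have Eg : dot g g = dot (grad f x) g - dot (grad f y) g.
  by rewrite {1}/g dotDl dotNl.
clearbody g.
have := bregman_le (x - L^-1 *: g) x hf.
have := bregman_ge0 (x - L^-1 *: g) y hf.
rewrite /bregman [_ - _ - y]addrAC [_ - _ - x]addrAC subrr add0r.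
rewrite !dotE Eg.
set a := dot (grad f x) g; set b := dot (grad f y) g; 
set c := dot _ x; set e := dot _ y.
set k := L^-1; set fz := f _; set fx := f x; set fy := f y => lo up.
have Lk : L * k = 1 by rewrite mulfV ?gt_eqF.
clearbody k.
move: up; rewrite [leRHS](_ : _ = (L * k) * (k * a - k * b) / 2); last by field.
rewrite Lk mul1r => up.
have : 0 <= 2 * L * (fx - fy - (c - e) - (k * a - k * b) / 2).
  apply: mulr_ge0; first by rewrite mulr_ge0 ?ltW.
  by move: lo up; lra.
rewrite [2 * L * (_ - _ / 2)]mulrBr subr_ge0.
have -> // : 2 * L * ((k * a - k * b) / 2) = (L * k) * (a - b) by field.
by rewrite Lk mul1r.
Qed.

End SmoothConvex.

(** * Expectations along an i.i.d. sequence of actions *)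

Lemma update_same (T : eqType) (V : Type) (g : T -> V) i v : update g i v i = v.
Proof. by rewrite /update eqxx. Qed.

Lemma update_diff (T : eqType) (V : Type) (g : T -> V) i j v :
  j != i -> update g i v j = g j.
Proof. by rewrite /update => /negPf->. Qed.

Section FiniteActions.
Context (n K : nat).

Definition action_code (a : action n K) : ('I_n * 'I_K) + 'I_n :=
  match a with Comm i k => inl (i, k) | Comp i => inr i end.

Definition action_decode (c : ('I_n * 'I_K) + 'I_n) : action n K :=
  match c with inl (i, k) => Comm i k | inr i => Comp i end.

Lemma action_codeK : cancel action_code action_decode. Proof. by case. Qed.
Lemma action_decodeK : cancel action_decode action_code.
Proof. by case=> [[]|]. Qed.

(** Averages over one draw are sums over all actions, which needs a finite type
    of actions. *)
HB.instance Definition _ := Finite.copy (action n K) (can_type action_codeK).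

Lemma sum_action (R : realType) (F : action n K -> R) :
  \sum_a F a = \sum_(i < n) \sum_(k < K) F (Comm i k) + \sum_(i < n) F (Comp i).
Proof.
rewrite (reindex action_decode); last first.
  by exists action_code => ? _; [exact: action_decodeK|exact: action_codeK].
by rewrite big_sumType /= pair_big; congr (_ + _); apply: eq_bigr => -[].
Qed.

End FiniteActions.

Section Process.
Context (R : realType) (A : finType) (p : A -> R).
Context (S : Type) (step : S -> A -> S).

Definition run (s0 : S) (a : nat -> A) (t : nat) : S :=
  iteri t (fun m s => step s (a m)) s0.

(** The transition operator of the Markov chain with this step. *)
Definition avg (G : S -> R) (s : S) : R := \sum_a p a * G (step s a).

Lemma eq_run s0 (a b : nat -> A) t :
  (forall s, (s < t)%N -> a s = b s) -> run s0 a t = run s0 b t.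
Proof.
elim: t => [//|t IH] ab; rewrite /run /= -!/(run _ _ _) IH ?ab// => s st.
by rewrite ab// ltnW.
Qed.

(** A drift condition iterates: if V majorises G and one averaged step shrinks
    V by the factor q on an invariant set, then k averaged steps of G are at
    most q ^+ k * V.  Only V needs a recursion, so G can be a quantity that is
    not itself monotone, such as the squared error. *)
Lemma iter_avg_le (inv : S -> Prop) (G V : S -> R) (q : R) :
  (forall a, 0 <= p a) -> 0 <= q ->
  (forall s a, inv s -> inv (step s a)) ->
  (forall s, inv s -> G s <= V s) ->
  (forall s, inv s -> avg V s <= q * V s) ->
  forall k s, inv s -> iter k avg G s <= q ^+ k * V s.
Proof.
move=> p0 q0 invS GV Vq; elim=> [|k IH] s invs; first by rewrite mul1r GV.
apply: (@le_trans _ _ (q ^+ k * avg V s)); last first.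
  by rewrite exprSr -mulrA ler_wpM2l ?exprn_ge0 ?Vq.
rewrite iterS {1}/avg mulr_sumr; apply: ler_sum => a _.
by rewrite mulrCA ler_wpM2l//; apply/IH/invS.
Qed.

Lemma avgZ (V : S -> R) (b : R) s : avg (fun s => b * V s) s = b * avg V s.
Proof. by rewrite /avg mulr_sumr; apply: eq_bigr => a _; rewrite mulrCA. Qed.

End Process.

Lemma iter_avg_counter (R : realType) (A : finType) (p : A -> R) (w : A -> nat)
    k m :
  \sum_a p a = 1 ->
  iter k (avg p (fun m a => m + w a)%N) (fun m => m%:R) m
  = m%:R + k%:R * \sum_a p a * (w a)%:R.
Proof.
move=> p1; elim: k m => [|k IH] m; first by rewrite mul0r addr0.
rewrite iterS /avg; under eq_bigr do rewrite IH natrD -addrA mulrDr mulrDr.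
rewrite 2!big_split /= -2!mulr_suml p1 !mul1r; congr (_ + _).
by rewrite -natr1 mulrDl mul1r addrC.
Qed.

Lemma run_counter (A : finType) (w : A -> nat) (a : nat -> A) t :
  run (fun m a => m + w a)%N 0%N a t = (\sum_(s < t) w (a s))%N.
Proof.
elim: t => [|t IH]; first by rewrite big_ord0.
by rewrite big_ord_recr /= -IH.
Qed.

Section Expectation.
Context (R : realType) (A : finType) (p : A -> R).
Context (disp : measure_display) (Omega : measurableType disp).
Context (P : probability Omega R) (X : nat -> Omega -> A).
Context (mX : forall t a, measurable (X t @^-1` [set a])).
Context (iidX : forall (t : nat) (a : nat -> A),
  P (\bigcap_(s < t) (X s @^-1` [set a s])) = (\prod_(s < t) p (a s))%:E).

(** Words of length t are encoded as sequences cut at t, so that appending a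
    letter is an [update] and needs no change of type. *)
Definition history (t : nat) (a : nat -> A) : set Omega :=
  \bigcap_(s < t) (X s @^-1` [set a s]).

Lemma measurable_history t a : measurable (history t a).
Proof. by apply: bigcap_measurableType => s _; exact: mX. Qed.

Lemma historyS t a :
  history t a = \big[setU/set0]_(b <- enum A) history t.+1 (update a t b).
Proof.
apply/seteqP; split=> [w aw|w].
  rewrite -bigcup_seq; exists (X t w); first by rewrite /= mem_enum.
  move=> s /=; rewrite ltnS leq_eqVlt /update; case: eqP => [-> //|_ /=].
  exact: aw.
rewrite -bigcup_seq => -[b _ bw] s st.
by have := bw s (ltnW st); rewrite /= /update ltn_eqF.
Qed.

Lemma trivIset_historyS t a (D : set A) :
  trivIset D (fun b => history t.+1 (update a t b)).
Proof.
move=> b c _ _ [w [bw cw]].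
have := bw t (ltnSn t); have := cw t (ltnSn t).
by rewrite /= !update_same => ->.
Qed.

Lemma measurable_fun_bigsetU d' (T : measurableType d') (I : Type) (r : seq I)
    (F : I -> set Omega) (f : Omega -> T) :
  (forall i, measurable (F i)) -> (forall i, measurable_fun (F i) f) ->
  measurable_fun (\big[setU/set0]_(i <- r) F i) f.
Proof.
move=> mF mf; elim: r => [|i r IH].
  by rewrite big_nil; exact: measurable_fun_set0.
rewrite big_cons; apply/measurable_funU => //.
exact: bigsetU_measurable.
Qed.

(** On the event that fixes the first t actions, the average over the k actions
    still to come can be computed exactly.  The induction is on k: the event
    splits into disjoint pieces according to the next action, down to events on
    which the integrand is constant.  Measurability has to be carried along,
    because the integral is additive over the pieces only for measurable
    integrands and the state space S has no measurable structure. *)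
Lemma integral_history (S : Type) (step : S -> A -> S) (s0 : S) (G : S -> R) :
  (forall s, 0 <= G s) -> forall k t a,
  let Y : Omega -> \bar R := fun w => (G (run step s0 (X ^~ w) (t + k)))%:E in
  measurable_fun (history t a) Y /\
  (\int[P]_(w in history t a) Y w =
   ((\prod_(s < t) p (a s)) * iter k (avg p step) G (run step s0 a t))%:E)%E.
Proof.
move=> G0; elim=> [|k IH] t a Y.
  have YE : {in history t a, Y =1 cst (G (run step s0 a t))%:E}.
    move=> w /set_mem aw; rewrite /Y addn0 /=; congr (G _)%:E.
    by apply: eq_run => s st; exact: aw.
  split; first by apply/(measurable_fun_eqP _ YE).
  rewrite (eq_integral (cst (G (run step s0 a t))%:E))//.
  rewrite integral_cst; last exact: measurable_history.
  by rewrite [X in (_ * X)%E](iidX t a) -EFinM mulrC.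
have mY : measurable_fun (history t a) Y.
  rewrite historyS; apply: measurable_fun_bigsetU => b.
    exact: measurable_history.
  by have [] := IH t.+1 (update a t b); rewrite addSnnS.
split=> //; move: mY; rewrite historyS => mY.
rewrite ge0_integral_bigsetU ?enum_uniq//; last 3 first.
- by move=> b; exact: measurable_history.
- exact: trivIset_historyS.
- by move=> w _; rewrite lee_fin.
rewrite iterS /avg mulr_sumr -sumEFin big_enum /=; apply: eq_bigr => b _.
have [_] := IH t.+1 (update a t b); rewrite addSnnS => ->.
rewrite big_ord_recr /= /run /= update_same -mulrA; congr (_ * (_ * _))%:E.
  by apply: eq_bigr => s _; rewrite update_diff ?ltn_eqF.
congr (iter _ _ _ (step _ _)); apply: eq_run => s st.
by rewrite update_diff ?ltn_eqF.
Qed.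

(** The case of the empty history in [integral_history], which a0 supplies. *)
Lemma expectation_run (a0 : A) (S : Type) (step : S -> A -> S) (s0 : S)
    (G : S -> R) k :
  (forall s, 0 <= G s) ->
  ('E_P[fun w => G (run step s0 (X ^~ w) k)] = (iter k (avg p step) G s0)%:E)%E.
Proof.
move=> G0; rewrite unlock.
have [_] := integral_history step s0 G0 k 0 (fun=> a0).
by rewrite /history bigcap_mkord big_ord0 big_ord0 mul1r.
Qed.

End Expectation.

Lemma tgd_run (R : realType) (n K d : nat) (L sigma p_comm p_comp : R)
  (f : 'I_n -> 'rV[R]_d -> R) z0 (a : nat -> action n K) t :
  tgd L sigma p_comm p_comp f z0 a t =
  run (tgd_step L sigma p_comm p_comp f) (tgd_init K sigma f z0) a t.
Proof. by elim: t => [//|t IH]; rewrite /= IH. Qed.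

Section ActionLaw.
Context (R : realType) (n : nat) (n0 : (0 < n)%N).
Local Notation p := (@action_prob R n 1 (1 / 2) (1 / 2)).
Let nR : n%:R != 0 :> R. Proof. by rewrite pnatr_eq0 -lt0n. Qed.

Lemma action_prob_ge0 a : 0 <= p a.
Proof. by case: a => [i k|i]; rewrite /= !divr_ge0. Qed.

Lemma sum_action_prob : \sum_a p a = 1.
Proof.
rewrite sum_action /=; under eq_bigr do rewrite big_ord1.
by rewrite !sumr_const card_ord -mulrnDl -[_ *+ n]mulr_natl; field.
Qed.

Lemma mean_is_comp i : \sum_a p a * (is_comp i a)%:R = (2 * n%:R)^-1.
Proof.
rewrite sum_action /= big1 ?add0r => [|j _]; last first.
  by rewrite big1// => k _; rewrite mulr0.
rewrite (bigD1 i)//= eqxx big1 => [|j /negPf ->]; last by rewrite mulr0.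
by rewrite mulr1 addr0; field.
Qed.

Lemma mean_is_comm k : \sum_a p a * (is_comm k a)%:R = 1 / 2.
Proof.
rewrite sum_action /= [X in _ + X]big1 ?addr0 => [|j _]; last by rewrite mulr0.
rewrite (ord1 k); under eq_bigr do rewrite big_ord1 mulr1.
by rewrite sumr_const card_ord -[_ *+ n]mulr_natl; field.
Qed.

(** A counter of actions is a Markov process of its own, so [expectation_run]
    applies to it as it does to the algorithm. *)
Lemma expected_count (disp : measure_display) (Omega : measurableType disp)
    (P : probability Omega R) (X : nat -> Omega -> action n 1)
    (w : action n 1 -> nat) T :
  iid_actions (1 / 2) (1 / 2) P X ->
  ('E_P[fun omega => (\sum_(t < T) w (X t omega))%N%:R]
   = (T%:R * \sum_a p a * (w a)%:R)%:E)%E.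
Proof.
move=> [mX iidX].
have -> : (fun omega => (\sum_(t < T) w (X t omega))%N%:R : R) =
  fun omega => (run (fun m a => m + w a)%N 0%N (X ^~ omega) T)%:R.
  by apply/funext => omega; rewrite run_counter.
rewrite (@expectation_run _ _ _ _ _ _ _ mX iidX (Comp (Ordinal n0)) nat
  (fun m a => m + w a)%N 0%N (fun m => m%:R))//.
by rewrite iter_avg_counter ?add0r// sum_action_prob.
Qed.

End ActionLaw.

(** * The drop of the potential at one node *)

(** First-order optimality, read off the quadratic upper bound on each f_i: if
    the gradient p of the objective at x were nonzero, the step of length
    1 / (n (L + sigma)) along - p would lower the objective. *)
Lemma minimizer_grad (R : realType) (n d : nat) (L sigma : R)
    (f : 'I_n -> 'rV[R]_d -> R) (x : 'rV[R]_d) :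
  0 < L -> 0 < sigma -> (forall i, local_function L (f i)) ->
  is_minimizer (objective sigma f) x ->
  \sum_(i < n) (grad (f i) x + sigma *: x) = 0.
Proof.
case: n f => [f _ _ _ _|n f L0 s0 hf minx]; first by rewrite big_ord0.
set p := \sum_i _; apply: dot_eq0.
pose t := (n.+1%:R * (L + sigma))^-1.
have n0 : 0 < n.+1%:R :> R by [].
have t0 : 0 < t by rewrite invr_gt0 mulr_gt0 ?addr_gt0.
have step i : f i (x - t *: p) + sigma / 2 * sqnorm (x - t *: p) <=
    f i x + sigma / 2 * sqnorm x - t * dot (grad (f i) x + sigma *: x) p
    + (L + sigma) / 2 * (t ^+ 2 * dot p p).
  have := bregman_le (x - t *: p) x (hf i).
  rewrite /bregman [_ - _ - x]addrAC subrr add0r !sqnormE !dotE (dotC p x).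
  by lra.
rewrite leNgt; apply/negP => pp; have := minx (x - t *: p).
rewrite /objective leNgt => /negP; apply.
apply: le_lt_trans (ler_sum _ (fun i _ => step i)) _.
rewrite big_split sumr_const card_ord /= big_split /= sumrN -mulr_sumr.
rewrite -dot_suml -/p -addrA gtrDl -[_ *+ n.+1]mulr_natl.
have -> : n.+1%:R * ((L + sigma) / 2 * (t ^+ 2 * dot p p)) =
  ((n.+1%:R * (L + sigma)) * t) * t * dot p p / 2 by field.
rewrite mulfV ?gt_eqF ?mulr_gt0 ?addr_gt0// mul1r.
have : 0 < t * dot p p by rewrite mulr_gt0.
by lra.
Qed.

(** Here c is the share of the regularization at one node, sigma_tilde. *)
Section NodeLyapunov.
Context (R : realType) (d : nat) (c L : R) (c0 : 0 < c) (L0 : 0 < L).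
Context (f : 'rV[R]_d -> R) (hf : local_function L f) (xs : 'rV[R]_d).
Implicit Types (z theta tau : 'rV[R]_d).

(** The deviation from its optimal value of theta + grad f z / c, the amount
    that the node has received from the token.  Computation steps leave it
    fixed. *)
Definition flow_gap z theta : 'rV[R]_d :=
  (theta - xs) + c^-1 *: (grad f z - grad f xs).

(** The first two terms are squared distances to the optimum, Euclidean for the
    flow and Bregman for the gradient, each divided by the step size of the
    corresponding move: c (c + L) / L is c / (2 rho_comm) and (c + L) / c is
    1 / rho_comp.  The last two are the share of the node in the dual gap. *)
Definition node_lyapunov z theta : R :=
  c * (c + L) / L * dot (flow_gap z theta) (flow_gap z theta)
  + (c + L) / c * bregman f z xs
  + (c / 2 * dot (theta - xs) (theta - xs) + bregman f xs z).

(** The share of the node in the inner product of the dual gradient with the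
    distance to the dual optimum. *)
Definition node_decrease z theta : R :=
  c * dot (theta - xs) (theta - xs) + dot (grad f z - grad f xs) (z - xs).

Lemma bregman_sym z :
  bregman f z xs + bregman f xs z = dot (grad f z - grad f xs) (z - xs).
Proof. by rewrite /bregman !dotE; lra. Qed.

(** With v = theta - tau, the dual gap falls by c r (1 - r) |v|^2, while the
    squared distance term grows by c r |v|^2 / 2 beyond its first-order change;
    r <= 1/2 makes the former at least the latter. *)
Lemma node_lyapunov_comm (r : R) z theta tau : r = L / (2 * (c + L)) ->
  node_lyapunov z (theta + r *: (tau - theta))
  + c / 2 * dot (tau - r *: (tau - theta) - xs) (tau - r *: (tau - theta) - xs)
  <= node_lyapunov z theta + c / 2 * dot (tau - xs) (tau - xs)
     - c * dot (flow_gap z theta) (theta - tau).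
Proof.
move=> rE; set v := theta - tau; rewrite /node_lyapunov.
have -> : tau - theta = - v by rewrite opprB.
have -> : tau - r *: - v - xs = (tau - xs) + r *: v.
  by rewrite scalerN opprK addrAC.
have -> : theta + r *: - v - xs = (theta - xs) - r *: v.
  by rewrite scalerN addrAC.
have -> : flow_gap z (theta + r *: - v) = flow_gap z theta - r *: v.
  by rewrite /flow_gap scalerN [_ - _ - xs]addrAC [LHS]addrAC.
have vE : dot v v = dot (theta - xs) v - dot (tau - xs) v.
  by rewrite -dotNl -dotDl opprB addrA subrK.
set u := flow_gap z theta; set e := theta - xs in vE *.
set e' := tau - xs in vE *.
clearbody v u e e'; rewrite !dotE (dotC v u) (dotC v e) (dotC v e').
have := dot_ge0 v; move: vE; set V := dot v v => vE V0.
have cL : c + L != 0 by rewrite gt_eqF ?addr_gt0.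
have L0' : L != 0 by rewrite gt_eqF.
have Ar : c * (c + L) / L * r = c / 2 by rewrite rE; field; rewrite cL.
have r0 : 0 < r by rewrite rE divr_gt0 ?mulr_gt0 ?addr_gt0.
have r1 : r <= 1 / 2.
  rewrite rE ler_pdivrMr ?mulr_gt0 ?addr_gt0// mulrA divfK// mul1r.
  by rewrite lerDr ltW.
(* Eliminating dot e v turns the claim into a polynomial identity in r. *)
have -> : dot e v = V + dot e' v by rewrite vE subrK.
rewrite -subr_ge0; set A := c * (c + L) / L in Ar *; set k := (c + L) / c.
clearbody A k.
rewrite [leRHS](_ : _ = (2 * (A * r) - c) * dot u v
  + (c - A * r - c * r) * r * V); last by field.
rewrite Ar [X in X * dot u v](_ : _ = 0) ?mul0r ?add0r; last by field.
have -> : c - c / 2 - c * r = c * (1 / 2 - r) by field.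
by rewrite !mulr_ge0 ?subr_ge0// ltW.
Qed.

(** Let q be the change of the gradient and D' = bregman f z z'.  Beyond the
    claimed drop, the term in bregman f _ xs changes by
    - (c + L) / c D' - <q, z - theta> and the dual gap by
    D' + |q|^2 / (2 c) + <q, z - theta>.  Cocoercivity bounds |q|^2 / (2 c) by
    L / c D', so the sum is at most 0. *)
Lemma node_lyapunov_comp (r : R) z z' theta : r = c / (c + L) ->
  z' = (1 - r) *: z + r *: theta ->
  node_lyapunov z' (theta - c^-1 *: (grad f z' - grad f z))
  <= node_lyapunov z theta - dot (grad f z - grad f xs) (z - theta).
Proof.
move=> rE z'E; rewrite /node_lyapunov; set q := grad f z' - grad f z.
have -> : flow_gap z' (theta - c^-1 *: q) = flow_gap z theta.
  rewrite /flow_gap [_ - _ - xs]addrAC -(addrA (theta - xs)).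
  congr (_ + _); rewrite addrC -scalerBr; congr (_ *: _).
  by rewrite /q opprB addrC addrA subrK.
have -> : theta - c^-1 *: q - xs = (theta - xs) - c^-1 *: q by rewrite addrAC.
have dz : z' - z = - r *: (z - theta).
  by rewrite z'E scalerBl scale1r addrAC [_ - _ - z]addrAC subrr add0r
    scaleNr scalerBr opprB addrC.
have D := bregman_cocoercive z z' L0 hf.
have hE : bregman f z' xs = bregman f z xs - bregman f z z'
    - r * dot (grad f z' - grad f xs) (z - theta).
  rewrite -mulrN -[- dot _ _]mulN1r mulrCA mulN1r -mulNr -dotZr -dz.
  by rewrite /bregman !dotE; lra.
have hdE : bregman f xs z' = bregman f xs z + bregman f z z' + dot q (z - xs).
  by rewrite /bregman /q !dotE; lra.
rewrite {}hE {}hdE.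
have qE : dot (grad f z' - grad f xs) (z - theta) =
  dot (grad f z - grad f xs) (z - theta) + dot q (z - theta).
  by rewrite -dotDl [in RHS]addrC /q addrA subrK.
rewrite qE.
have -> : z - xs = (z - theta) + (theta - xs) by rewrite addrA subrK.
have {}D : dot q q <= 2 * L * bregman f z z'.
  by rewrite /q -(opprB (grad f z)) dotNl dotNr opprK.
clearbody q; set e := theta - xs; set w := z - theta; clearbody e w.
set D' := bregman f z z' in D *; set G := dot (_ - _) w.
set U := dot (flow_gap _ _) _; set A := c * (c + L) / L.
set h := bregman f z xs; set hd := bregman f xs z.
clearbody D' G U A h hd; rewrite !dotE (dotC q e) -subr_ge0.
have cL : c + L != 0 by rewrite gt_eqF ?addr_gt0.
have c0' : c != 0 by rewrite gt_eqF.
rewrite [leRHS](_ : _ = (2 * L * D' - dot q q) / (2 * c)).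
  by rewrite divr_ge0 ?subr_ge0// mulr_ge0// ltW.
by rewrite rE; field; rewrite c0' cL.
Qed.

(** The only term that is not bounded at once is the flow gap e + g / c, with
    g the gradient difference.  Young's inequality with weight L on the cross
    term and |g|^2 <= L <g, z - xs> give
    c |e + g / c|^2 <= (c + L) / c (c |e|^2 + <g, z - xs>). *)
Lemma node_lyapunov_le z theta :
  node_lyapunov z theta <= (c + L) / c * (3 + c / L) * node_decrease z theta.
Proof.
rewrite /node_lyapunov /node_decrease.
have := bregman_sym z; have := bregman_ge0 z xs hf; have := bregman_ge0 xs z hf.
have := bregman_cocoercive z xs L0 hf; have := bregman_cocoercive xs z L0 hf.
rewrite -(opprB (grad f z)) dotNl dotNr opprK /flow_gap.
have := dot_ge0 (L *: (theta - xs) - (grad f z - grad f xs)).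
have := dot_ge0 (theta - xs).
set e := theta - xs; set g := grad f z - grad f xs; set S := dot g (z - xs).
set h := bregman f z xs; set hd := bregman f xs z; set k := (c + L) / c.
clearbody e g S h hd; rewrite !dotE (dotC g e).
set ee := dot e e; set eg := dot e g; set gg := dot g g.
move=> ee0 cs coco1 coco2 hd0 h0 hS.
have c0' : c != 0 by rewrite gt_eqF.
have L0' : L != 0 by rewrite gt_eqF.
have k1 : 1 <= k by rewrite ler_pdivlMr// mul1r lerDl ltW.
have N0 : 0 <= c * ee + S.
  by rewrite addr_ge0 ?mulr_ge0 ?(ltW c0)// -hS addr_ge0.
have uu : c * (ee + c^-1 * eg + (c^-1 * eg + c^-1 * (c^-1 * gg)))
    <= k * (c * ee + S).
  rewrite -subr_ge0 (_ : _ - _ = (L * (L * ee) - L * eg - (L * eg - gg)) / L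
    + (c + L) / (c * L) * (L * S - gg)); last first.
    by rewrite /k; field; rewrite c0' L0'.
  rewrite addr_ge0//; first by rewrite divr_ge0 ?(ltW L0)//; lra.
  apply: mulr_ge0; first by rewrite ltW// divr_gt0 ?mulr_gt0 ?addr_gt0.
  by rewrite -hS mulrDr; move: coco1 coco2; rewrite -!mulrA; lra.
set UU := (X in c * X <= _) in uu *; set N := c * ee + S in uu N0 *.
have t0 : 0 <= 1 + c / L by rewrite addr_ge0 ?ltW ?divr_gt0.
have -> : c * (c + L) / L * UU = (1 + c / L) * (c * UU) by field.
have -> : k * (3 + c / L) * N = (1 + c / L) * (k * N) + k * N + k * N by field.
have cee : 0 <= c * ee by rewrite mulr_ge0 ?(ltW c0).
have hN : k * h <= k * N.
  by apply: ler_wpM2l; [exact: le_trans ler01 k1|rewrite /N -hS; lra].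
have NN : N <= k * N by rewrite ler_peMl.
apply: lerD; first exact: lerD (ler_wpM2l t0 uu) hN.
by apply: le_trans NN; rewrite /N -hS; lra.
Qed.

Lemma node_lyapunov_ge z theta :
  c / 2 * dot (theta - xs) (theta - xs) <= node_lyapunov z theta.
Proof.
rewrite /node_lyapunov addrCA lerDl.
have h0 := bregman_ge0 z xs hf; have h1 := bregman_ge0 xs z hf.
have A0 : 0 <= c * (c + L) / L by rewrite ltW// divr_gt0 ?mulr_gt0 ?addr_gt0.
have k0 : 0 <= (c + L) / c by rewrite ltW// divr_gt0 ?addr_gt0.
apply: addr_ge0 => //; apply: addr_ge0; last exact: mulr_ge0.
by apply: mulr_ge0 => //; exact: dot_ge0.
Qed.

(** The sum of the first-order drops of the two possible moves of a node.  Its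
    dependence on the token is linear in the flow gap, so it can be summed over
    the nodes with [sum_flow_gap]. *)
Lemma node_decreaseE z theta tau :
  c * dot (flow_gap z theta) (theta - tau)
    + dot (grad f z - grad f xs) (z - theta)
  = node_decrease z theta - c * dot (flow_gap z theta) (tau - xs).
Proof.
have -> : theta - tau = (theta - xs) - (tau - xs) by rewrite opprB addrA subrK.
have -> : z - theta = (z - xs) - (theta - xs) by rewrite opprB addrA subrK.
rewrite /node_decrease /flow_gap.
set e := theta - xs; set g := grad f z - grad f xs; set w := z - xs.
clearbody e g w; rewrite !dotE; field.
by rewrite gt_eqF.
Qed.

Lemma node_decrease_ge0 z theta : 0 <= node_decrease z theta.
Proof.
rewrite /node_decrease -bregman_sym; apply: addr_ge0.
  by apply: mulr_ge0; [exact: ltW|exact: dot_ge0].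
by rewrite addr_ge0 ?(bregman_ge0 _ _ hf).
Qed.

End NodeLyapunov.

(** * The potential of the whole network *)

Lemma sum_changed (V : zmodType) (I : finType) (i : I) (F F' : I -> V) :
  (forall j, j != i -> F' j = F j) ->
  \sum_j F' j = \sum_j F j + (F' i - F i).
Proof.
move=> FF'; rewrite (bigD1 i)//= [in RHS](bigD1 i)//= (eq_bigr _ FF').
by rewrite addrC [in RHS]addrAC subrKC addrC.
Qed.

Section Lyapunov.
Context (R : realType) (n d : nat) (L sigma : R) (n0 : (0 < n)%N).
Context (L0 : 0 < L) (sigma0 : 0 < sigma).
Context (f : 'I_n -> 'rV[R]_d -> R) (hf : forall i, local_function L (f i)).
Context (xs : 'rV[R]_d) (xs_min : is_minimizer (objective sigma f) xs).

Local Notation c := (sigma_tilde n 1 sigma).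
Local Notation state := (state R n 1 d).
Local Notation step := (tgd_step L sigma (1 / 2) (1 / 2) f).
Local Notation p := (@action_prob R n 1 (1 / 2) (1 / 2)).

Let nR : 0 < n%:R :> R. Proof. by rewrite ltr0n. Qed.

Lemma sigma_tilde_gt0 : 0 < c.
Proof. by rewrite mulr_gt0 ?divr_gt0// ltr0n addn_gt0 n0. Qed.
Let c0 := sigma_tilde_gt0.

(** With a single token and equal probabilities the second argument of the
    minimum is always the smaller one. *)
Lemma etaE :
  Defs.eta n 1 L sigma (1 / 2) (1 / 2) = L * c / (4 * n%:R * (c + L)).
Proof.
have c0' : c != 0 by rewrite gt_eqF.
have L0' : L != 0 by rewrite gt_eqF.
have nR' : n%:R != 0 :> R by rewrite gt_eqF.
have cL' : c + L != 0 by rewrite gt_eqF ?addr_gt0.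
rewrite /Defs.eta /alpha /=; set x := _ / (n%:R * _ * _).
have -> : x = L * c / (4 * n%:R * (c + L)).
  by rewrite /x; field; rewrite nR' L0' c0' cL'.
apply/min_idPr; rewrite -subr_ge0 [leRHS](_ : _ = c * c / (4 * n%:R * (c + L))).
  by rewrite ltW// divr_gt0 ?mulr_gt0 ?addr_gt0.
by field; rewrite nR' cL'.
Qed.

Lemma rho_commE : rho_comm n 1 L sigma (1 / 2) (1 / 2) = L / (2 * (c + L)).
Proof.
rewrite /rho_comm etaE; field.
by rewrite !gt_eqF ?addr_gt0.
Qed.

Lemma rho_compE : rho_comp n 1 L sigma (1 / 2) (1 / 2) = c / (c + L).
Proof.
rewrite /rho_comp etaE /alpha; field.
by rewrite !gt_eqF ?addr_gt0.
Qed.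

(** What the nodes have received equals what the token has given away, since
    everything starts from zero. *)
Definition mass_balanced (s : state) : Prop :=
  \sum_i (node_theta s i + c^-1 *: grad (f i) (node_z s i))
  + token_theta s ord0 = 0.

Lemma mass_balanced_init z0 : mass_balanced (tgd_init 1 sigma f z0).
Proof. by rewrite /mass_balanced addr0 big1// => i _; rewrite addNr. Qed.

Lemma mass_balanced_step s a : mass_balanced s -> mass_balanced (step s a).
Proof.
rewrite /mass_balanced => bal; case: a => [i k|i] /=.
  rewrite (ord1 k) update_same (sum_changed (i := i)
    (F := fun j => node_theta s j + c^-1 *: grad (f j) (node_z s j))).
    have cancel (a x y t : 'rV[R]_d) : a + x + y - (a + y) + (t - x) = t.
      by rewrite [a + x + y]addrAC [a + y + x]addrC addrK subrKC.
    by rewrite update_same -[RHS]bal -addrA cancel.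
  by move=> j ji; rewrite update_diff.
rewrite (sum_changed (i := i)
    (F := fun j => node_theta s j + c^-1 *: grad (f j) (node_z s j))).
  have cancel (t a b : 'rV[R]_d) : t - (a - b) + a - (t + b) = 0.
    by rewrite opprB addrA subrK subrr.
  by rewrite !update_same scalerBr cancel addr0.
by move=> j ji; rewrite !update_diff.
Qed.

(** Subtract from the balance of masses the same balance at the rest point,
    which is first-order optimality because n sigma = (n + 1) sigma_tilde. *)
Lemma sum_flow_gap s : mass_balanced s ->
  \sum_i flow_gap c (f i) xs (node_z s i) (node_theta s i)
  = - (token_theta s ord0 - xs).
Proof.
move=> /eqP; rewrite addr_eq0 => /eqP bal.
have opt := minimizer_grad L0 sigma0 hf xs_min.
have -> : \sum_i flow_gap c (f i) xs (node_z s i) (node_theta s i) =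
  \sum_i (node_theta s i + c^-1 *: grad (f i) (node_z s i))
  - \sum_i (xs + c^-1 *: grad (f i) xs).
  rewrite -sumrB; apply: eq_bigr => i _.
  by rewrite /flow_gap scalerBr opprD addrACA.
rewrite bal opprB addrC; congr (_ - _); apply/eqP.
rewrite eqr_oppLR -addr_eq0 big_split /= -scaler_sumr sumr_const card_ord.
have -> : \sum_i grad (f i) xs = - (sigma *: xs *+ n).
  apply/eqP; rewrite -addr_eq0 -[X in _ *+ X](card_ord n) -sumr_const.
  by rewrite -big_split opt.
rewrite -[_ *: xs *+ n]scaler_nat -[xs *+ n]scaler_nat scalerN !scalerA.
rewrite -[X in _ + X == 0]scale1r -scalerBl -scalerDl; apply/eqP.
rewrite [X in X *: _](_ : _ = 0) ?scale0r//.
rewrite /sigma_tilde natrD; field.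
by rewrite !gt_eqF// ltr_wpDr.
Qed.

Definition lyapunov (s : state) : R :=
  \sum_i node_lyapunov c L (f i) xs (node_z s i) (node_theta s i)
  + c / 2 * dot (token_theta s ord0 - xs) (token_theta s ord0 - xs).

Definition decrease (s : state) : R :=
  \sum_i node_decrease c (f i) xs (node_z s i) (node_theta s i)
  + c * dot (token_theta s ord0 - xs) (token_theta s ord0 - xs).

Lemma lyapunov_comm s i k :
  lyapunov (step s (Comm i k)) <= lyapunov s
  - c * dot (flow_gap c (f i) xs (node_z s i) (node_theta s i))
          (node_theta s i - token_theta s ord0).
Proof.
rewrite (ord1 k) /lyapunov /= update_same rho_commE.
rewrite (sum_changed (i := i) (F := fun j =>
  node_lyapunov c L (f j) xs (node_z s j) (node_theta s j))); last first.
  by move=> j ji; rewrite update_diff.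
rewrite update_same.
have := node_lyapunov_comm c0 L0 (f i) xs (node_z s i) (node_theta s i)
  (token_theta s ord0) erefl.
by lra.
Qed.

Lemma lyapunov_comp s i :
  lyapunov (step s (Comp i)) <= lyapunov s
  - dot (grad (f i) (node_z s i) - grad (f i) xs) (node_z s i - node_theta s i).
Proof.
rewrite /lyapunov /= rho_compE.
rewrite (sum_changed (i := i) (F := fun j =>
  node_lyapunov c L (f j) xs (node_z s j) (node_theta s j))); last first.
  by move=> j ji; rewrite !update_diff.
rewrite !update_same.
have := node_lyapunov_comp c0 L0 (hf i) xs (r := c / (c + L))
  (z := node_z s i) (theta := node_theta s i) erefl erefl.
by lra.
Qed.

(** Each of the 2 n actions has probability 1 / (2 n), so the mean drop is the
    sum of the drops over all coordinates, up to that factor. *)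
Lemma avg_lyapunov s : mass_balanced s ->
  avg p step lyapunov s <= lyapunov s - decrease s / (2 * n%:R).
Proof.
move=> /sum_flow_gap gap.
pose q : R := (2 * n%:R)^-1.
have q0 : 0 <= q by rewrite invr_ge0 mulr_ge0.
rewrite /avg sum_action; under eq_bigr do rewrite big_ord1.
rewrite -big_split /=.
pose D i := c * dot (flow_gap c (f i) xs (node_z s i) (node_theta s i))
    (node_theta s i - token_theta s ord0)
  + dot (grad (f i) (node_z s i) - grad (f i) xs) (node_z s i - node_theta s i).
have DE : \sum_i D i = decrease s.
  rewrite /D; under eq_bigr do rewrite node_decreaseE//.
  by rewrite sumrB -mulr_sumr -dot_suml gap dotNl mulrN opprK.
apply: (@le_trans _ _ (\sum_(i < n) q * (2 * lyapunov s - D i))).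
  apply: ler_sum => i _; have := lyapunov_comm s i ord0.
  have := lyapunov_comp s i.
  have qE : 1 / 2 / n%:R = q by rewrite /q; field; rewrite gt_eqF.
  rewrite mulr1 qE.
  move=> H1 H2; rewrite -mulrDr; apply: ler_wpM2l => //.
  by move: H1 H2; rewrite /D; lra.
rewrite -mulr_sumr sumrB DE sumr_const card_ord -mulr_natl.
by rewrite /q le_eqVlt; apply/orP; left; apply/eqP; field; rewrite gt_eqF.
Qed.

Lemma lyapunov_le_decrease s :
  lyapunov s <= (c + L) / c * (3 + c / L) * decrease s.
Proof.
rewrite /lyapunov /decrease [leRHS]mulrDr [X in _ <= X + _]mulr_sumr.
apply: lerD.
  by apply: ler_sum => i _; exact: node_lyapunov_le.
set e := dot _ _; have e0 : 0 <= e by exact: dot_ge0.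
rewrite mulrCA -mulrA; apply: ler_wpM2l; first exact: ltW.
have k1 : 1 <= (c + L) / c by rewrite ler_pdivlMr// mul1r lerDl ltW.
have t0 : 0 <= c / L by rewrite ltW ?divr_gt0.
apply: ler_wpM2r => //; have t1 : 1 <= 3 + c / L by lra.
by have := mulr_ege1 k1 t1; lra.
Qed.

Lemma decrease_ge0 s : 0 <= decrease s.
Proof.
apply: addr_ge0; last by apply: mulr_ge0; [exact: ltW|exact: dot_ge0].
by apply: sumr_ge0 => i _; exact: (node_decrease_ge0 c0 (hf i)).
Qed.

Lemma lyapunov_ge0 s : 0 <= lyapunov s.
Proof.
have c2 : 0 <= c / 2 by rewrite divr_ge0 ?(ltW c0).
apply: addr_ge0; last by apply: mulr_ge0 => //; exact: dot_ge0.
apply: sumr_ge0 => i _; apply: le_trans (node_lyapunov_ge c0 L0 (hf i) xs _ _).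
by apply: mulr_ge0 => //; exact: dot_ge0.
Qed.

Lemma sqerror_le_lyapunov s : sqerror s xs <= 2 / c * lyapunov s.
Proof.
have c2 : 0 < c / 2 by rewrite divr_gt0.
have -> : 2 / c = (c / 2)^-1 by rewrite invf_div.
rewrite ler_pdivlMl// /sqerror big_ord1 mulrDr mulr_sumr sqnormE lerD2r.
by apply: ler_sum => i _; rewrite sqnormE node_lyapunov_ge.
Qed.

(** B is left free because the condition number attached to sigma_tilde is
    only comparable to, not equal to, the one attached to sigma. *)
Lemma avg_lyapunov_contract (B : R) s :
  0 < B -> (c + L) / c * (3 + c / L) <= B -> mass_balanced s ->
  avg p step lyapunov s <= expR (- (2 * n%:R * B)^-1) * lyapunov s.
Proof.
move=> B0 B_ge bal; apply: le_trans (avg_lyapunov bal) _.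
apply: (@le_trans _ _ ((1 - (2 * n%:R * B)^-1) * lyapunov s)); last first.
  by rewrite ler_wpM2r ?lyapunov_ge0 ?expR_ge1Dx.
rewrite mulrBl mul1r lerD2l lerN2 invfM -mulrA [leRHS]mulrC.
rewrite ler_wpM2l ?invr_ge0 ?mulr_ge0// ler_pdivrMl//.
apply: le_trans (lyapunov_le_decrease s) _.
by apply: ler_wpM2r => //; exact: decrease_ge0.
Qed.

End Lyapunov.

(** * Rate and number of steps *)

(** The factor 2 is the worst case n = 1 of (n + 1) / n, the ratio of sigma to
    sigma_tilde.  The lower bound kappa0 enters through c / L <= sigma / L: as
    kappa tends to 1 the communication step size L / (2 (c + L)) tends to 0, and
    no bound of this form holds uniformly. *)
Lemma condition_number_le (R : realType) (n : nat) (L sigma kappa0 : R) :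
  let c := sigma_tilde n 1 sigma in
  (0 < n)%N -> 0 < L -> 0 < sigma -> 1 < kappa0 -> kappa0 <= 1 + L / sigma ->
  (c + L) / c * (3 + c / L)
    <= (1 + L / sigma) * (2 * (3 + (kappa0 - 1)^-1)).
Proof.
move=> c n0 L0 sigma0 kappa0_gt1 kappa_ge.
have c0 : 0 < c := sigma_tilde_gt0 n0 sigma0.
have nR : 0 < n%:R :> R by rewrite ltr0n.
have nn : n%:R + 1 <= 2 * n%:R :> R by rewrite mulrDl mul1r lerD2l ler1n.
have cE : c = n%:R / (n%:R + 1) * sigma by rewrite /c /sigma_tilde natrD.
rewrite mulrA [_ * 2]mulrC; apply: ler_pM.
- by rewrite ltW// divr_gt0// addr_gt0.
- by rewrite addr_ge0// ltW// divr_gt0.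
- have -> : (c + L) / c = 1 + (n%:R + 1) / n%:R * (L / sigma).
    by rewrite cE; field; rewrite !gt_eqF// ltr_wpDr.
  have ratio_le2 : (n%:R + 1) / n%:R <= 2 :> R by rewrite ler_pdivrMr.
  have Ls0 : 0 < L / sigma by rewrite divr_gt0.
  by have := ler_wpM2r (ltW Ls0) ratio_le2; lra.
- rewrite lerD2l; apply: (@le_trans _ _ (sigma / L)).
    rewrite ler_pM2r ?invr_gt0// cE ler_piMl ?(ltW sigma0)//.
    by rewrite ler_pdivrMr ?mul1r ?lerDl// ltr_wpDr.
  rewrite -[sigma / L]invf_div lef_pV2 ?posrE ?subr_gt0 ?divr_gt0//.
  by rewrite lerBlDl.
Qed.

(** Rounding a real stopping time down to T loses at most one step, that is a
    factor expR delta, which is why the initialization constant carries it. *)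
Lemma expR_decay_le (R : realType) (delta M eps l : R) (T : nat) :
  0 < M -> 0 < eps -> ln (M * expR delta / eps) <= l ->
  l < delta * T.+1%:R -> expR (- delta) ^+ T * M <= eps.
Proof.
move=> M0 eps0 ln_le lT.
have ratio_gt0 : 0 < M * expR delta / eps.
  by rewrite divr_gt0 ?mulr_gt0 ?expR_gt0.
rewrite -expRM_natl -ler_pdivlMr// mulrN mulrC.
apply: (@le_trans _ _ (expR (delta - ln (M * expR delta / eps)))).
  by move: lT; rewrite ler_expR -natr1 mulrDr mulr1; lra.
rewrite expRD expRN lnK ?posrE// invf_div le_eqVlt; apply/orP; left; apply/eqP.
by field; rewrite !gt_eqF ?expR_gt0.
Qed.

Theorem theorem1 (R : realType) (kappa0 : R) (hkappa0 : 1 < kappa0) :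
  exists C : R, 0 < C /\
  forall (n d : nat) (L sigma : R) (f : 'I_n -> 'rV[R]_d -> R)
    (theta_star : 'rV[R]_d) (z0 : 'I_n -> 'rV[R]_d),
  let kappa := 1 + L / sigma in
  (0 < n)%N -> 0 < L -> 0 < sigma -> kappa0 <= kappa ->
  (forall i, local_function L (f i)) ->
  is_minimizer (objective sigma f) theta_star ->
  exists C0 : R, 0 < C0 /\
  forall eps : R, 0 < eps ->
  exists T : nat,
  forall (disp : measure_display) (Omega : measurableType disp)
    (P : probability Omega R) (X : nat -> Omega -> action n 1),
  iid_actions (1 / 2) (1 / 2) P X ->
  [/\ forall t : nat, (T <= t)%N ->
        (expected_sqerror L sigma (1 / 2) (1 / 2) f z0 theta_star P X t
           <= eps%:E)%E,
      forall i : 'I_n,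
        (expected_comp P X T i <= (C * kappa * log_ratio C0 eps)%:E)%E
    & forall k : 'I_1,
        (expected_comm P X T k <= (C * n%:R * kappa * log_ratio C0 eps)%:E)%E].
Proof.
have [C CE] : {C : R | C = 2 * (3 + (kappa0 - 1)^-1)} by eexists.
exists C.
have C0 : 0 < C by rewrite CE mulr_gt0// addr_gt0// invr_gt0 subr_gt0.
split=> // n d L sigma f xs z0 kappa n0 L0 sigma0 kappa_ge hf xs_min.
have nR : 0 < n%:R :> R by rewrite ltr0n.
have kappa_gt0 : 0 < kappa.
  by rewrite (lt_le_trans _ kappa_ge)// (lt_trans ltr01).
set c := sigma_tilde n 1 sigma; have c0 : 0 < c := sigma_tilde_gt0 n0 sigma0.
have c2 : 0 <= 2 / c by rewrite ltW// divr_gt0.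
pose delta := (2 * n%:R * (kappa * C))^-1.
have delta0 : 0 < delta by rewrite invr_gt0 !mulr_gt0.
pose V := lyapunov L sigma f xs.
pose step := @tgd_step R n 1 d L sigma (1 / 2) (1 / 2) f.
pose p := @action_prob R n 1 (1 / 2) (1 / 2).
have V_contract s : mass_balanced sigma f s ->
    avg p step V s <= expR (- delta) * V s.
  apply: (avg_lyapunov_contract n0 L0 sigma0 hf xs_min); rewrite ?mulr_gt0//.
  by rewrite CE; exact: condition_number_le.
set s0 := tgd_init 1 sigma f z0.
(* The summand 1 keeps M positive when the run starts at the optimum. *)
pose M := 2 / c * V s0 + 1.
have W0 : 0 <= 2 / c * V s0 by rewrite mulr_ge0// lyapunov_ge0.
have M0 : 0 < M by rewrite ltr_wpDl.
(* The factor expR delta pays for rounding the number of steps down. *)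
exists (M * expR delta); split; first by rewrite mulr_gt0 ?expR_gt0.
move=> eps eps0; set l := log_ratio _ eps.
have l0 : 0 <= l by rewrite /l /log_ratio le_max lexx.
pose T := Num.truncn (l / delta).
have T_le : T%:R <= l / delta by rewrite truncn_le divr_ge0// ltW.
exists T => disp Omega P X iidX; split.
- move=> t Tt; rewrite /expected_sqerror.
  have [mX prodX] := iidX.
  under eq_fun do rewrite tgd_run.
  rewrite (@expectation_run _ _ _ _ _ _ _ mX prodX (Comp (Ordinal n0)) _
    step s0 (fun s => sqerror s xs)); last first.
    by move=> s; rewrite addr_ge0// sumr_ge0// => i _; rewrite sqnormE dot_ge0.
  rewrite lee_fin.
  apply: (@le_trans _ _ (expR (- delta) ^+ t * (2 / c * V s0))).
    apply: (@iter_avg_le R _ p _ step (mass_balanced sigma f) _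
      (fun s => 2 / c * V s)).
    + exact: action_prob_ge0.
    + exact: expR_ge0.
    + by move=> s a; exact: mass_balanced_step.
    + by move=> s _; exact: sqerror_le_lyapunov.
    + by move=> s bal; rewrite avgZ mulrCA ler_wpM2l ?V_contract.
    + exact: mass_balanced_init.
  apply: (@le_trans _ _ (expR (- delta) ^+ T * M)).
    apply: ler_pM; rewrite ?exprn_ge0 ?expR_ge0//; last by rewrite lerDl.
    by apply: ler_wiXn2l => //; rewrite ?expR_ge0// expR_le1 oppr_le0 ltW.
  apply: (@expR_decay_le _ _ _ _ l) => //; first by rewrite le_max lexx orbT.
  by have := truncnS_gt (l / delta); rewrite ltr_pdivrMr// mulrC.
- move=> i; rewrite /expected_comp (expected_count n0 (is_comp i) T iidX).
  rewrite mean_is_comp// lee_fin -ler_pdivlMr ?invr_gt0 ?mulr_gt0//.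
  by apply: le_trans T_le _; rewrite /delta !invrK; lra.
- move=> k; rewrite /expected_comm (expected_count n0 (is_comm k) T iidX).
  rewrite mean_is_comm// lee_fin.
  by move: T_le; rewrite /delta !invrK; lra.
Qed.
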